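(* Let $X$ be a random vector with values in a real separable F-space $B$, with law $\mu$, let $t_k:B\to\mathbb{R}$, $k\ge1$, be Borel measurable functionals, and assume $\{t_k(X): k\ge 1\}$ are independent, symmetric (about zero) random variables with variances $\sigma_k^2\in(0,\infty)$, $k\ge 1$. In addition, assume that conditions (A-I) and (A-II) below both hold, or that condition (A-III) below holds: (A-I) for every $a\in B$ and all integers $d\ge 1$, $HD_{\mathbb{R}^d}(\Pi_d(a),\mu^{\Pi_d})>0$, where $\Pi_d(a)=(t_1(a),\ldots,t_d(a))$ and $\mu^{\Pi_d}$ is the image of $\mu$ on $\mathbb{R}^d$ under the map $\Pi_d:B\to\mathbb{R}^d$; (A-II) for some constant $c<\infty$, $\mathbb{E}(t_k^4(X))\le c[\mathbb{E}(t_k^2(X))]^2$ for all $k\ge1$; (A-III) $\{t_k(X)/\lambda_k: k\ge1\}$, for some constants $0<\lambda_k<\infty$, are i.i.d. with a probability density $\phi$ that is positive almost everywhere (Lebesgue), absolutely continuous on every compact interval of $\mathbb{R}$, and satisfies $$\int_{\mathbb{R}}\frac{(\phi'(x))^2}{\phi(x)}\,dx<\infty\quad\text{and}\quad \int_{\mathbb{R}}x^2\phi(x)\,dx<\infty.$$ Then, for $a\in B$ and $\mathcal{T}$ the set of all finite linear combinations of the maps $\{t_k:k\ge1\}$, $$HD_{\mathcal{T}}(a,\mu)>0\quad\text{if and only if}\quad \sum_{k\ge1}\frac{t_k^2(a)}{\sigma_k^2}<\infty.$$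
   Context: A real separable F-space is a real topological vector space whose topology is induced by a complete, separable, translation invariant metric; it carries its Borel sigma-field. $X$ is defined on a probability space $(\Omega,\mathcal{F},P)$, is Borel measurable, and $\mu=\mathcal{L}(X)$. For a collection $\mathcal{T}$ of Borel measurable functionals on $B$ and $a\in B$, the half space depth is $$HD_{\mathcal{T}}(a,\mu)=\inf_{t\in\mathcal{T}}P(t(X)\ge t(a))=\inf_{t\in\mathcal{T}}\mu(x\in B: t(x)\ge t(a)).$$ For a Borel probability $\nu$ on $\mathbb{R}^d$ and $b\in\mathbb{R}^d$, $HD_{\mathbb{R}^d}(b,\nu)=\inf_{t}\nu(x\in\mathbb{R}^d: t(x)\ge t(b))$, the infimum being over all linear functionals $t$ on $\mathbb{R}^d$ (Tukey half space depth). The functionals $t_k$ are not assumed linear or continuous. *)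

(* Defs.v *)
From HB Require Import structures.
From mathcomp Require Import all_boot all_order all_algebra.
From mathcomp Require Import all_classical all_reals all_analysis.

Set Implicit Arguments.
Unset Strict Implicit.
Unset Printing Implicit Defensive.

Import Order.TTheory GRing.Theory Num.Theory.
Import numFieldNormedType.Exports.

Local Open Scope classical_set_scope.
Local Open Scope ring_scope.

Definition is_metric (R : realType) (T : Type) (dist : T -> T -> R) : Prop :=
  [/\ forall x y, 0 <= dist x y,
      forall x y, dist x y = 0 <-> x = y,
      forall x y, dist x y = dist y x &
      forall x y z, dist x z <= dist x y + dist y z].

(* Unlike a tvsType, a topologicalLmodType need not be locally convex. *)
Definition separable_Fspace (R : realType) (B : topologicalLmodType R) : Prop :=
  exists dist : B -> B -> R,
    [/\ is_metric dist,
        forall x : B, nbhs x = filter_from [set e : R | 0 < e]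
                                 (fun e => [set y | dist x y < e]),
        forall x y z, dist (x + z) (y + z) = dist x y,
        forall u : nat -> B,
          (forall e : R, 0 < e ->
             \forall m & n \near \oo, dist (u m) (u n) < e) ->
          exists l : B, u @ \oo --> l &
        exists2 D : set B, countable D & dense D].

(* B with its Borel sigma-field: g_sigma_algebraType (@open B) is not used
   because it needs a pointedType, which a topologicalLmodType is not. *)
Definition borel (R : realType) (B : topologicalLmodType R) : Type := B.

Section borel_instances.
Context {R : realType} (B : topologicalLmodType R).

Let borel0 : <<s @open B >> set0. Proof. exact: sigma_algebra0. Qed.

Let borelC (A : set B) : <<s @open B >> A -> <<s @open B >> (~` A).
Proof. by move=> BA; rewrite -setTD; exact: sigma_algebraCD. Qed.

Let borel_bigcup (A : (set B)^nat) :
  (forall i, <<s @open B >> (A i)) -> <<s @open B >> (\bigcup_i A i).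
Proof. exact: sigma_algebra_bigcup. Qed.

HB.instance Definition _ := Choice.copy (borel B) B.
HB.instance Definition _ := isPointed.Build (borel B) (0 : B).
HB.instance Definition _ := @isMeasurable.Build (sigma_display (@open B))
  (borel B) <<s @open B >> borel0 borelC borel_bigcup.

End borel_instances.

Section depth.
Context {R : realType}.

Definition half_space_depth (T : Type) (F : set (T -> R)) (a : T)
    (mu : set T -> \bar R) : \bar R :=
  ereal_inf [set mu [set x | t a <= t x] | t in F].

Definition tukey_depth (n : nat) (b : 'rV[R]_n)
    (nu : set (borel 'rV[R]_n) -> \bar R) : \bar R :=
  half_space_depth (range (fun t : {scalar 'rV[R]_n} => t : 'rV[R]_n -> R))
    b nu.

Definition linear_combinations (T : Type) (t : nat -> T -> R) : set (T -> R) :=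
  [set s | exists (n : nat) (c : 'I_n -> R),
             s = fun x => \sum_(k < n) c k * t k x].

Definition coordinates (T : Type) (t : nat -> T -> R) (n : nat) (a : T) :
    'rV[R]_n :=
  \row_(k < n) t k a.

End depth.

Section random_variables.
Context {d : measure_display} {Omega : measurableType d} {R : realType}.
Variable P : probability Omega R.

Definition mutually_independent (Y : nat -> Omega -> R) : Prop :=
  forall (J : seq nat) (A : nat -> set R), uniq J ->
    (forall k, measurable (A k)) ->
    P (\bigcap_(k in [set` J]) (Y k @^-1` A k)) =
      (\prod_(k <- J) P (Y k @^-1` A k))%E.

Definition symmetric_rv (Y : Omega -> R) : Prop :=
  forall A : set R, measurable A -> P (Y @^-1` A) = P ((\- Y) @^-1` A).

Definition identically_distributed (Y : nat -> Omega -> R) : Prop :=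
  forall (j k : nat) (A : set R), measurable A ->
    P (Y j @^-1` A) = P (Y k @^-1` A).

Definition has_density (Y : Omega -> R) (phi : R -> R) : Prop :=
  [/\ measurable_fun [set: R] phi, (forall x, 0 <= phi x) &
      forall A : set R, measurable A ->
        P (Y @^-1` A) = (\int[lebesgue_measure]_(x in A) (phi x)%:E)%E].

End random_variables.

Definition absolutely_continuous_on (R : realType) (a b : R) (f : R -> R) :
    Prop :=
  forall e : R, 0 < e -> exists2 delta : R, 0 < delta &
    forall (n : nat) (u v : 'I_n -> R),
      (forall i, [/\ a <= u i, u i <= v i & v i <= b]) ->
      trivIset [set: 'I_n] (fun i => `]u i, v i[%classic) ->
      \sum_(i < n) (v i - u i) < delta ->
      \sum_(i < n) `|f (v i) - f (u i)| < e.

Section conditions.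
Context {d : measure_display} {Omega : measurableType d} {R : realType}.
Variables (P : probability Omega R) (B : topologicalLmodType R).
Variables (X : {RV P >-> borel B}) (t : nat -> {mfun borel B >-> R}).

Definition condition_AI : Prop :=
  forall (a : B) (n : nat), (0 < n)%N ->
    (0 < tukey_depth (coordinates t n a)
           (pushforward (distribution P X)
              (coordinates t n : borel B -> borel 'rV[R]_n)))%E.

Definition condition_AII : Prop :=
  exists c : R, forall k,
    ('E_P[fun w => (t k (X w) ^+ 4)%R] <=
       c%:E * 'E_P[fun w => (t k (X w) ^+ 2)%R] ^+ 2)%E.

(* The derivative of phi, which exists almost everywhere, is the total function
   derive1 phi; neither its value where phi is not differentiable nor the
   convention x / 0 = 0 affects the integral of derive1 phi ^+ 2 / phi. *)
Definition condition_AIII : Prop :=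
  exists (lambda : nat -> R) (phi : R -> R),
    (forall k, 0 < lambda k) /\
    [/\ mutually_independent P (fun k w => t k (X w) / lambda k),
        identically_distributed P (fun k w => t k (X w) / lambda k) &
        forall k, has_density P (fun w => t k (X w) / lambda k) phi] /\
    [/\ {ae lebesgue_measure, forall x, 0 < phi x},
        (forall a b, absolutely_continuous_on a b phi),
        (\int[lebesgue_measure]_x (derive1 phi x ^+ 2 / phi x)%:E < +oo)%E &
        (\int[lebesgue_measure]_x (x ^+ 2 * phi x)%:E < +oo)%E].

End conditions.

(* Main.v *)
(* Write Y_k = t_k(X). If the half-space depth is at least h > 0, Chebyshev's
   inequality for sum_k (t_k(a) / sigma_k^2) Y_k bounds the partial sums of
   sum_k t_k(a)^2 / sigma_k^2 by 1 / h. Conversely, a half space splits into a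
   head (k < N) and an independent tail. The head has a probability bounded
   away from 0, by (A-I), or because in case (A-III) it contains the orthant
   {sgn(c_k) Y_k >= |t_k(a)|}. For a tail S = sum c_k Y_k of variance 1, let
   S' = sum c_k g_k(Y_k), where g_k = id under (A-II) and g_k is bounded and odd
   under (A-III): E[S S'] is bounded below and E[S'^4] above, which bounds
   P(S >= eta) from below, for some eta > 0 depending neither on N nor on c. *)

Require Import Defs.
From HB Require Import structures.
From mathcomp Require Import all_boot all_order all_algebra.
From mathcomp Require Import all_classical all_reals all_analysis.
From mathcomp Require Import measurable_realfun.
From mathcomp Require Import ring lra.

Set Implicit Arguments.
Unset Strict Implicit.
Unset Printing Implicit Defensive.

Import Order.TTheory GRing.Theory Num.Theory.
Import numFieldNormedType.Exports.

Local Open Scope classical_set_scope.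
Local Open Scope ring_scope.

(** The order of choices shapes the converse. Once the tail is divided by its standard deviation,
    Cauchy-Schwarz keeps its threshold below the square root of the sum of t_k(a)^2 / sigma_k^2 over
    k >= N. Thus N is chosen to bring this below eta, which requires eta to be known beforehand; the
    bound on the head may then depend on N in any way. A Paley-Zygmund argument on S alone would
    need its fourth moment, which (A-III) does not provide. Testing S against S' moves the fourth
    moment to a variable that has one: E[S S'] >= kappa, E[S^2] = 1 and E[S'^4] <= C force E|S| >= D
    with D = kappa^2 / (2 (1 + C)). As E[S] = 0, half of E|S| comes from the positive part of S, and
    E[S^2] = 1 prevents that mass from sitting on a very small event. *)

Lemma measurable_superlevel (d : measure_display) (T : measurableType d)
    (R : realType) (f : T -> R) (b : R) :
  measurable_fun setT f -> measurable [set w | b <= f w].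
Proof.
move=> mf; have := mf measurableT _ (measurable_itv `[b, +oo[).
rewrite setTI; congr measurable.
by apply/seteqP; split=> w /=; rewrite in_itv/= andbT.
Qed.

(** * Independent pairs: generated sigma-fields and Fubini *)

Section independence.
Context {d : measure_display} {T : measurableType d} {R : realType}.
Variable P : probability T R.

Definition independent_rv2 d1 d2 (T1 : measurableType d1)
    (T2 : measurableType d2) (U : T -> T1) (V : T -> T2) : Prop :=
  forall (A : set T1) (B : set T2), measurable A -> measurable B ->
    (P ((U @^-1` A) `&` (V @^-1` B)) = P (U @^-1` A) * P (V @^-1` B))%E.

Lemma independent_rv2_comp d1 d2 d3 d4 (T1 : measurableType d1)
    (T2 : measurableType d2) (T3 : measurableType d3) (T4 : measurableType d4)
    (U : T -> T1) (V : T -> T2) (f : T1 -> T3) (g : T2 -> T4) :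
  measurable_fun setT f -> measurable_fun setT g ->
  independent_rv2 U V -> independent_rv2 (f \o U) (g \o V).
Proof.
move=> mf mg UV A B mA mB; apply: (UV (f @^-1` A) (g @^-1` B)).
- by rewrite -[X in measurable X]setTI; exact: mf.
- by rewrite -[X in measurable X]setTI; exact: mg.
Qed.

Lemma dynkin_independent (B : set T) : measurable B ->
  dynkin [set A | measurable A /\ (P (A `&` B) = P A * P B)%E].
Proof.
move=> mB; split => /=.
- by split => //; rewrite setTI probability_setT mul1e.
- move=> A [mA AB]; split; first exact: measurableC.
  rewrite setIC -setDE.
  rewrite measureD//=; last first.
    by rewrite (le_lt_trans (probability_le1 P mB))// ltry.
  rewrite (setIC B A) AB probability_setC//.
  rewrite -(fineK (fin_num_measure P _ mA)) -(fineK (fin_num_measure P _ mB)).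
  by rewrite -EFinM -!EFinB -EFinM mulrBl mul1r.
- move=> F tF AB; split.
    by apply: bigcup_measurable => k _; exact: (AB k).1.
  rewrite setI_bigcupl measure_bigcup//=; last 2 first.
    by move=> k _; apply: measurableI => //; exact: (AB k).1.
    exact: trivIset_setIr.
  rewrite (measure_bigcup P)//; last by move=> k _; exact: (AB k).1.
  rewrite -(fineK (fin_num_measure P _ mB)) muleC -nneseriesZl//.
  apply: eq_eseriesr => k _; rewrite muleC fineK ?fin_num_measure//.
  exact: (AB k).2.
Qed.

Lemma independent_g_sigma_algebra_l (G : set_system T) (B : set T) :
  setI_closed G -> G `<=` measurable -> measurable B ->
  (forall A, G A -> P (A `&` B) = P A * P B)%E ->
  forall A, <<s G >> A -> measurable A /\ (P (A `&` B) = P A * P B)%E.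
Proof.
move=> GI Gm mB GB; apply: lambda_system_subset => //.
- exact/dynkin_lambda_system/dynkin_independent.
- by move=> A GA; split; [exact: Gm|exact: GB].
Qed.

(** The pi-lambda argument runs once in each variable: [A] in the generated sigma-field is held
    fixed while [H] is extended, and inside that step a generator of [H] is held fixed while [G] is
    extended. *)
Lemma independent_g_sigma_algebra (G H : set_system T) :
  setI_closed G -> G `<=` measurable -> setI_closed H -> H `<=` measurable ->
  (forall A B, G A -> H B -> P (A `&` B) = P A * P B)%E ->
  forall A B, <<s G >> A -> <<s H >> B -> (P (A `&` B) = P A * P B)%E.
Proof.
move=> GI Gm HI Hm GH A B sA sB.
have mA : measurable A.
  apply: (@smallest_sub _ (sigma_algebra setT) G measurable _ Gm A sA).
  exact: sigma_algebra_measurable.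
rewrite setIC muleC; apply: (independent_g_sigma_algebra_l HI Hm mA _ sB).2.
move=> C HC; rewrite setIC muleC.
apply: (independent_g_sigma_algebra_l GI Gm (Hm _ HC) _ sA).2.
by move=> D GD; exact: GH.
Qed.


(** The joint law agrees with the product law on rectangles, hence everywhere. The disjunction lets
    the lemma serve twice for a product U V: by nonnegativity for |U V|, which proves integrability,
    then by integrability for U V itself. *)
Lemma independent_rv2_integral d1 d2 (T1 : measurableType d1)
    (T2 : measurableType d2) (U : T -> T1) (V : T -> T2)
    (f : T1 * T2 -> \bar R) :
  measurable_fun setT U -> measurable_fun setT V -> independent_rv2 U V ->
  measurable_fun setT f ->
  P.-integrable setT (fun w => f (U w, V w)) \/ (forall z, 0 <= f z)%E ->
  (\int[P]_w f (U w, V w) =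
   \int[pushforward P U]_x \int[pushforward P V]_y f (x, y))%E.
Proof.
move=> mU mV UV mf h.
pose U' : {RV P >-> T1} := HB.pack U (isMeasurableFun.Build _ _ _ _ U mU).
pose V' : {RV P >-> T2} := HB.pack V (isMeasurableFun.Build _ _ _ _ V mV).
have mW := measurable_fun_pair mU mV.
pose W : {RV P >-> (T1 * T2)%type} :=
  HB.pack (fun w => (U w, V w)) (isMeasurableFun.Build _ _ _ _ _ mW).
have mE A : measurable A -> A `<=` setT -> distribution P W A =
    (distribution P U' \x distribution P V')%E A.
  move=> mA _; apply/esym; apply: product_measure_unique => [C D mC mD|//].
  exact: (UV C D mC mD).
have eqI g : (\int[distribution P W]_z g z =
    \int[distribution P U' \x distribution P V']_z g z)%E.
  exact: eq_measure_integral.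
have eqW : (\int[P]_w f (U w, V w) = \int[distribution P W]_z f z)%E.
  case: h => h; first by rewrite integral_distribution.
  by rewrite ge0_integral_distribution.
rewrite eqW eqI; case: h => h; last by rewrite fubini_tonelli1.
rewrite -integral12_prod_meas1//.
apply/integrableP; split => //; rewrite -eqI.
rewrite ge0_integral_distribution//; last exact: measurableT_comp.
by case/integrableP : h.
Qed.

Lemma independent_rv2M (U V : T -> R) :
  measurable_fun setT U -> measurable_fun setT V -> independent_rv2 U V ->
  P.-integrable setT (EFin \o U) -> P.-integrable setT (EFin \o V) ->
  P.-integrable setT (EFin \o (fun w => U w * V w)) /\
  \int[P]_w (U w * V w) = (\int[P]_w U w) * (\int[P]_w V w).
Proof.
move=> mU mV UV iU iV.
pose g (z : R * R) : \bar R := (z.1 * z.2)%:E.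
have mg : measurable_fun setT g.
  by apply/measurable_EFinP; apply: measurable_funM.
pose U' : {RV P >-> R} := HB.pack U (isMeasurableFun.Build _ _ _ _ U mU).
pose V' : {RV P >-> R} := HB.pack V (isMeasurableFun.Build _ _ _ _ V mV).
have iUV : P.-integrable setT (EFin \o (fun w => U w * V w)).
  apply/integrableP; split.
    by apply/measurable_EFinP; exact: measurable_funM.
  rewrite (independent_rv2_integral (f := abse \o g) mU mV UV)//;
    last 2 first.
    exact: measurableT_comp.
    by right => z; exact: abse_ge0.
  have mabs : measurable_fun [set: R] (fun y => `|y|%:E).
    by apply/measurable_EFinP; exact: normr_measurable.
  under eq_integral => x _.
    rewrite (_ : integral _ _ _ = `|x|%:E * \int[pushforward P V]_y `|y|%:E)%E.
      over.
    rewrite -ge0_integralZl//.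
    by apply: eq_integral => y _; rewrite /g/= normrM.
  rewrite /= ge0_integralZr//; last exact: integral_ge0.
  case/integrableP : iU => _ iU; case/integrableP : iV => _ iV.
  rewrite (@ge0_integral_distribution _ _ _ _ _ P U' (fun x => `|x|%:E))//.
  rewrite (@ge0_integral_distribution _ _ _ _ _ P V' (fun x => `|x|%:E))//.
  have h W : (0 <= \int[P]_x ((fun x : R => `|x|%:E) \o W) x)%E.
    by apply: integral_ge0 => x _; rewrite /= lee_fin.
  by apply: lte_mul_pinfty => //; rewrite ge0_fin_numE.
split => //; rewrite /Rintegral.
rewrite (independent_rv2_integral (f := g) mU mV UV)//; last by left.
have iV' : (pushforward P V).-integrable setT (EFin : R -> \bar R).
  exact: integrable_pushforward.
have iU' : (pushforward P U).-integrable setT (EFin : R -> \bar R).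
  exact: integrable_pushforward.
rewrite -fineM; [|exact: integrable_fin_num..].
congr fine.
transitivity (\int[pushforward P U]_x (x%:E * (\int[P]_w (V w)%:E)))%E.
  apply: eq_integral => [//|x _].
  transitivity (\int[distribution P V']_y (x%:E * y%:E))%E => //.
  by rewrite integralZl// integral_distribution.
have -> : (\int[P]_w (V w)%:E)%E = (\int[P]_w V w)%:E.
  by rewrite fineK//; exact: integrable_fin_num iV.
rewrite integralZr//; congr (_ * _)%E.
transitivity (\int[distribution P U']_y y%:E)%E => //.
by rewrite integral_distribution.
Qed.

End independence.

(** * Disjoint blocks of an independent sequence *)

Section mutual_independence.
Context {d : measure_display} {T : measurableType d} {R : realType}.
Variables (P : probability T R) (Y : nat -> T -> R).
Hypothesis mY : forall k, measurable_fun setT (Y k).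
Hypothesis indepY : mutually_independent P Y.

(** A pi-system generating the sigma-field of the [Y k], k in [J]. Its events are coded by families
    over all of [nat], the form in which [mutually_independent] takes them. *)
Definition cylinders (J : seq nat) : set_system T :=
  [set E | exists2 A : nat -> set R, (forall k, measurable (A k)) &
     E = \bigcap_(k in [set` J]) (Y k @^-1` A k)].

Let setI_closed_cylinders J : setI_closed (cylinders J).
Proof.
move=> _ _ [A mA ->] [B mB ->]; exists (fun k => A k `&` B k).
  by move=> k; exact: measurableI.
by rewrite -bigcapI.
Qed.

Let measurable_cylinders J : cylinders J `<=` measurable.
Proof.
move=> _ [A mA ->].
apply: fin_bigcap_measurable => // k _.
by rewrite -[X in measurable X]setTI; exact: mY.
Qed.

Let independent_cylinders J K A B : uniq (J ++ K) ->
  cylinders J A -> cylinders K B -> (P (A `&` B) = P A * P B)%E.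
Proof.
rewrite cat_uniq => /and3P[uJ JK uK] [A' mA ->] [B' mB ->].
(* Glues the two families into one, so that mutual independence applies to [J ++ K], to [J] and to
   [K] with the same sets. *)
pose C k := if k \in J then A' k else B' k.
have mC k : measurable (C k) by rewrite /C; case: ifP.
have KJ k : k \in K -> k \notin J.
  by move=> kK; apply/negP => kJ; move/hasPn/(_ k kK)/negP : JK.
have EJ : \bigcap_(k in [set` J]) (Y k @^-1` A' k) =
    \bigcap_(k in [set` J]) (Y k @^-1` C k).
  by apply: eq_bigcapr => k /= kJ; rewrite /C kJ.
have EK : \bigcap_(k in [set` K]) (Y k @^-1` B' k) =
    \bigcap_(k in [set` K]) (Y k @^-1` C k).
  by apply: eq_bigcapr => k /= /KJ kJ; rewrite /C (negbTE kJ).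
rewrite EJ EK -bigcap_setU.
have -> : [set` J] `|` [set` K] = [set` J ++ K].
  by apply/seteqP; split=> k /=; rewrite mem_cat => /orP.
rewrite !indepY ?big_cat// cat_uniq uJ uK andbT.
exact: JK.
Qed.

Let measurable_sum_cylinders (f : nat -> R -> R) J (A : set R) :
  (forall k, measurable_fun setT (f k)) -> measurable A ->
  <<s cylinders J >> ((fun w => \sum_(k <- J) f k (Y k w)) @^-1` A).
Proof.
move=> mf mA.
pose T' := g_sigma_algebraType (cylinders J).
(* Measurability of the sum is derived from that of every summand, whatever its index; the test
   replaces by 0 those that the cylinders over [J] do not control. *)
have mS : measurable_fun setT
    ((fun w => \sum_(k <- J) (if k \in J then f k (Y k w) else 0)) : T' -> R).
  apply: measurable_sum => k; have [kJ|//] := boolP (k \in J).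
  apply: measurableT_comp; first exact: mf.
  move=> _ B mB; rewrite setTI; apply: sub_sigma_algebra.
  exists (fun j => if j == k then B else setT) => [j|]; first by case: ifP.
  apply/seteqP; split=> w /= => [Bw j jJ|/(_ k kJ)]; last by rewrite /= eqxx.
  by rewrite /=; case: eqP => // ->.
have := mS measurableT _ mA; rewrite setTI; congr (<<s _ >> _).
apply/funext => w /=; congr A.
by rewrite [RHS]big_seq [LHS]big_seq; apply: eq_bigr => k ->.
Qed.

Lemma independent_rv2_sum (f g : nat -> R -> R) (J K : seq nat) :
  (forall k, measurable_fun setT (f k)) ->
  (forall k, measurable_fun setT (g k)) -> uniq (J ++ K) ->
  independent_rv2 P (fun w => \sum_(k <- J) f k (Y k w))
                    (fun w => \sum_(k <- K) g k (Y k w)).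
Proof.
move=> mf mg uJK A B mA mB.
apply: (@independent_g_sigma_algebra _ _ _ P (cylinders J) (cylinders K)) => //.
- by move=> ? ?; exact: independent_cylinders.
- exact: measurable_sum_cylinders.
- exact: measurable_sum_cylinders.
Qed.

End mutual_independence.

(** * A calculus of finite means *)

Section has_mean.
Context {d : measure_display} {T : measurableType d} {R : realType}.
Variable P : probability T R.

(** Integrability travels with the value, because the real-valued integral alone says nothing when
    the extended one is infinite: [fine] sends it to 0. *)
Definition has_mean (f : T -> R) (m : R) : Prop :=
  P.-integrable setT (EFin \o f) /\ \int[P]_w f w = m.

Lemma has_mean_measurable f m : has_mean f m -> measurable_fun setT f.
Proof. by case=> /measurable_int /measurable_EFinP. Qed.

Lemma has_meanD f g a b : has_mean f a -> has_mean g b ->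
  has_mean (fun w => f w + g w) (a + b).
Proof.
move=> [fi <-] [gi <-]; split; last by rewrite RintegralD.
by have := integrableD measurableT fi gi.
Qed.

Lemma has_meanZ f a c : has_mean f a -> has_mean (fun w => c * f w) (c * a).
Proof.
move=> [fi <-]; split; last by rewrite RintegralZl.
by have := integrableZl measurableT c fi.
Qed.

Lemma has_mean_indic (A : set T) : measurable A ->
  has_mean (\1_A : T -> R) (fine (P A)).
Proof.
move=> mA; split; last by rewrite /Rintegral integral_indic// setIT.
exact: integrable_indic.
Qed.

Lemma has_mean_cst c : has_mean (fun=> c) c.
Proof.
split; first exact: finite_measure_integrable_cst.
by rewrite Rintegral_cst//= probability_setT mulr1.
Qed.

Lemma has_mean_le f g a b : has_mean f a -> has_mean g b ->
  (forall w, f w <= g w) -> a <= b.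
Proof. by move=> [fi <-] [gi <-] fg; exact: le_Rintegral. Qed.

Lemma has_meanM f g a b : independent_rv2 P f g ->
  has_mean f a -> has_mean g b -> has_mean (fun w => f w * g w) (a * b).
Proof.
move=> fg hf hg; have mf := has_mean_measurable hf.
have mg := has_mean_measurable hg.
case: hf hg => fi <- [gi <-].
exact: independent_rv2M.
Qed.

Lemma has_mean_eq f g a b : has_mean f a -> f =1 g -> a = b -> has_mean g b.
Proof. by move=> fa /funext <- <-. Qed.

Lemma has_mean_dominated (f g : T -> R) b :
  measurable_fun setT f -> has_mean g b ->
  (forall w, `|f w| <= g w) -> exists a, has_mean f a.
Proof.
move=> mf [gi _] fg; eexists; split; last by [].
apply: le_integrable gi => //; first exact/measurable_EFinP.
move=> w _ /=; rewrite lee_fin (le_trans (fg w))// ler_norm //.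
Qed.

End has_mean.

(** * Second and fourth moments of sums of independent centred variables *)

Section moments_of_sums.
Context {d : measure_display} {T : measurableType d} {R : realType}.
Variables (P : probability T R) (Y : nat -> T -> R).
Hypothesis mY : forall k, measurable_fun setT (Y k).
Hypothesis indepY : mutually_independent P Y.

Lemma independent_rv2_block (f g : nat -> R -> R) (N n : nat) (p q : R -> R) :
  (forall k, measurable_fun setT (f k)) ->
  (forall k, measurable_fun setT (g k)) ->
  measurable_fun setT p -> measurable_fun setT q -> (N <= n)%N ->
  independent_rv2 P (fun w => p (\sum_(N <= k < n) f k (Y k w)))
                    (fun w => q (g n (Y n w))).
Proof.
move=> mf mg mp mq Nn.
have uI : uniq (index_iota N n ++ [:: n]).
  by rewrite cats1 rcons_uniq iota_uniq mem_index_iota ltnn andbF.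
have H := independent_rv2_sum mY indepY mf mg uI.
have := independent_rv2_comp mp mq H; congr independent_rv2.
by apply/funext => w /=; rewrite big_seq1.
Qed.

Lemma has_mean_sum (f : nat -> R -> R) N n :
  (forall k, has_mean P (fun w => f k (Y k w)) 0) ->
  has_mean P (fun w => \sum_(N <= k < n) f k (Y k w)) 0.
Proof.
move=> f0; elim: n => [|n IH].
  apply: (has_mean_eq (has_mean_cst P 0)) => // w; by rewrite big_geq.
have [Nn|nN] := leqP N n.
  apply: (has_mean_eq (has_meanD IH (f0 n))); last by rewrite addr0.
  by move=> w; rewrite big_nat_recr.
by apply: (has_mean_eq (has_mean_cst P 0)) => // w; rewrite big_geq.
Qed.

(** Independence and zero means remove the cross terms. It yields the variance of S when [f] and [g]
    coincide, and otherwise the covariance of S and S'. *)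
Lemma has_mean_sum_mul_sum (f g : nat -> R -> R) (m : nat -> R) N n :
  (forall k, measurable_fun setT (f k)) ->
  (forall k, measurable_fun setT (g k)) ->
  (forall k, has_mean P (fun w => f k (Y k w)) 0) ->
  (forall k, has_mean P (fun w => g k (Y k w)) 0) ->
  (forall k, has_mean P (fun w => f k (Y k w) * g k (Y k w)) (m k)) ->
  has_mean P (fun w => (\sum_(N <= k < n) f k (Y k w)) *
                       (\sum_(N <= k < n) g k (Y k w)))
             (\sum_(N <= k < n) m k).
Proof.
move=> mf mg f0 g0 fg; elim: n => [|n IH].
  by apply: (has_mean_eq (has_mean_cst P 0)) => [w|]; rewrite !big_geq// mul0r.
have [Nn|nN] := leqP N n; last first.
  by apply: (has_mean_eq (has_mean_cst P 0)) => [w|]; rewrite !big_geq// mul0r.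
have mid : measurable_fun setT (@id R) by exact: measurable_id.
have I1 := independent_rv2_block mf mg mid mid Nn.
have I2 := independent_rv2_block mg mf mid mid Nn.
have H1 := has_meanM I1 (has_mean_sum N n f0) (g0 n).
have H2 := has_meanM I2 (has_mean_sum N n g0) (f0 n).
apply: (has_mean_eq (has_meanD (has_meanD IH H1)
  (has_meanD H2 (fg n)))) => [w|].
  by rewrite !(big_nat_recr n)//=; ring.
by rewrite !(big_nat_recr n)//=; ring.
Qed.

(** Adding an independent centred term f to a sum S leaves E[S^4] + 6 E[S^2] E[f^2] + E[f^4].
    Compared with C (W + s)^2 = C W^2 + 2 C W s + C s^2, the middle term asks for 6 <= 2 C. The
    bounds use [s] instead of [m2] because the dual variables are controlled by the variances of the
    [Y k], not by their own. *)
Lemma has_mean_sum_pow4 (f : nat -> R -> R) (m2 m3 m4 s : nat -> R) (C : R)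
    N n :
  3 <= C ->
  (forall k, measurable_fun setT (f k)) ->
  (forall k, has_mean P (fun w => f k (Y k w)) 0) ->
  (forall k, has_mean P (fun w => f k (Y k w) ^+ 2) (m2 k)) ->
  (forall k, has_mean P (fun w => f k (Y k w) ^+ 3) (m3 k)) ->
  (forall k, has_mean P (fun w => f k (Y k w) ^+ 4) (m4 k)) ->
  (forall k, m2 k <= s k) -> (forall k, m4 k <= C * s k ^+ 2) ->
  exists2 m, has_mean P (fun w => (\sum_(N <= k < n) f k (Y k w)) ^+ 4) m &
    m <= C * (\sum_(N <= k < n) s k) ^+ 2.
Proof.
move=> C3 mf f1 f2 f3 f4 m2s m4s.
have S1 j := has_mean_sum N j f1.
have S2 j : has_mean P (fun w => (\sum_(N <= k < j) f k (Y k w)) ^+ 2)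
    (\sum_(N <= k < j) m2 k).
  by apply: has_mean_sum_mul_sum.
have V0 j : 0 <= \sum_(N <= k < j) m2 k.
  by apply: (has_mean_le (has_mean_cst P 0) (S2 j)) => w; exact: sqr_ge0.
have m20 k : 0 <= m2 k.
  by apply: (has_mean_le (has_mean_cst P 0) (f2 k)) => w; exact: sqr_ge0.
(* The third moment joins the induction to make the cross term 4 S^3 f integrable. *)
suff [m [m' [_ H1 H2]]] : exists m m', [/\
    has_mean P (fun w => (\sum_(N <= k < n) f k (Y k w)) ^+ 3) m',
    has_mean P (fun w => (\sum_(N <= k < n) f k (Y k w)) ^+ 4) m &
    m <= C * (\sum_(N <= k < n) s k) ^+ 2] by exists m.
elim: n => [|n [q4 [q3 [IH3 IH4 le4]]]].
  exists 0, 0; split.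
  - apply: (has_mean_eq (has_mean_cst P 0)) => [w|//].
    by rewrite big_geq// expr0n.
  - apply: (has_mean_eq (has_mean_cst P 0)) => [w|//].
    by rewrite big_geq// expr0n.
  - by rewrite big_geq// expr0n mulr0.
have [Nn|nN] := leqP N n; last first.
  exists 0, 0; split.
  - apply: (has_mean_eq (has_mean_cst P 0)) => [w|//].
    by rewrite big_geq// expr0n.
  - apply: (has_mean_eq (has_mean_cst P 0)) => [w|//].
    by rewrite big_geq// expr0n.
  - by rewrite big_geq// expr0n mulr0.
have I (i j : nat) : independent_rv2 P
    (fun w => (\sum_(N <= k < n) f k (Y k w)) ^+ i)
    (fun w => (f n (Y n w)) ^+ j).
  by apply: (independent_rv2_block mf mf _ _ Nn (p := fun x => x ^+ i)
    (q := fun x => x ^+ j)); exact: measurable_funX.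
have H21 := has_meanZ 3 (has_meanM (I 2%N 1%N) (S2 n) (f1 n)).
have H12 := has_meanZ 3 (has_meanM (I 1%N 2%N) (S1 n) (f2 n)).
have H31 := has_meanZ 4 (has_meanM (I 3%N 1%N) IH3 (f1 n)).
have H22 := has_meanZ 6 (has_meanM (I 2%N 2%N) (S2 n) (f2 n)).
have H13 := has_meanZ 4 (has_meanM (I 1%N 3%N) (S1 n) (f3 n)).
do 2 eexists; split.
- apply: (has_mean_eq (has_meanD (has_meanD IH3 H21)
    (has_meanD H12 (f3 n)))) => [w|].
    by rewrite !(big_nat_recr n)//=; ring.
  by reflexivity.
- apply: (has_mean_eq (has_meanD (has_meanD (has_meanD IH4 H31)
    (has_meanD H22 H13)) (f4 n))) => [w|].
    by rewrite !(big_nat_recr n)//=; ring.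
  by reflexivity.
- rewrite !(big_nat_recr n)//=.
  have := ler_pM (V0 n) (m20 n)
    (ler_sum_nat (fun k _ => m2s k) : _ <= \sum_(N <= k < n) s k) (m2s n).
  have W0 : 0 <= \sum_(N <= k < n) s k.
    by rewrite (le_trans (V0 n))// ler_sum_nat.
  set V := \sum_(_ <= _ < _) m2 _; set W := \sum_(_ <= _ < _) s _ in le4 W0 *.
  have sn0 : 0 <= s n by rewrite (le_trans (m20 n)).
  have := mulr_ge0 W0 sn0; have := m4s n.
  move=> le4n Ws VW.
  have : 0 <= (C - 3) * (W * s n) by rewrite mulr_ge0// subr_ge0.
  by nra.
Qed.

End moments_of_sums.

(** * A one-sided lower bound on probabilities from moments *)

Section tail_bound.
Context {d : measure_display} {T : measurableType d} {R : realType}.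
Variable P : probability T R.

(* Integrating the pointwise bounds [S S' <= b |S| + (S^2 + S'^4) / (2 b)] and
   [|S| <= 2 eta + g S^2 + 1_{S >= eta} / g - S], with [b], [g] and [eta = D / 8]
   chosen to balance the terms. *)
Lemma tail_lower_bound (S S' : T -> R) (kappa k q C D : R) :
  has_mean P S 0 -> has_mean P (fun w => S w ^+ 2) 1 ->
  has_mean P (fun w => S w * S' w) k -> has_mean P (fun w => S' w ^+ 4) q ->
  0 < kappa -> kappa <= k -> 0 < C -> q <= C ->
  D = kappa ^+ 2 / (2 * (1 + C)) ->
  D ^+ 2 / 8 <= fine (P [set w | D / 8 <= S w]).
Proof.
move=> S1 S2 SS' S4 kappa0 kappak C0 qC DE'.
have mA : measurable [set w | D / 8 <= S w].
  exact/measurable_superlevel/(has_mean_measurable S1).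
have D0 : 0 < D by rewrite DE' divr_gt0// ?exprn_gt0// mulr_gt0// addr_gt0.
set p := fine _.
(* With this [b] the term (S^2 + S'^4) / (2 b) has mean at most [kappa / 2], which leaves E|S| >=
   kappa / (2 b) = [D]. Since 2 eta + g = D / 2, the indicator term must then account for at least
   [D / 2]. *)
pose b := (1 + C) / kappa.
have b0 : 0 < b by rewrite divr_gt0// addr_gt0.
have bE : b * kappa = 1 + C by rewrite divfK// gt_eqF.
have DE : b * D = kappa / 2.
  rewrite DE' /b; field; rewrite !gt_eqF//= ?addr_gt0//.
pose g := D / 4; have g0 : 0 < g by rewrite divr_gt0.
have H := has_meanD (has_meanZ b
    (has_meanD (has_meanD (has_mean_cst P (2 * (D / 8))) (has_meanZ g S2))
       (has_meanD (has_meanZ g^-1 (has_mean_indic P mA)) (has_meanZ (-1) S1))))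
    (has_meanZ (2 * b)^-1 (has_meanD S2 S4)).
have sum_ge0 x : 0 <= 2 * (D / 8) + g * x ^+ 2.
  by rewrite addr_ge0// mulr_ge0// ?sqr_ge0// ltW// divr_gt0.
have bound1 w : `|S w| <= 2 * (D / 8) + g * S w ^+ 2 +
    (g^-1 * \1_[set w | D / 8 <= S w] w + (-1) * S w).
  set x := S w; rewrite indicE.
  have [Dx|Dx] := leP (D / 8) x.
    rewrite mem_set// mulr1 ger0_norm; last first.
      by rewrite (le_trans _ Dx)// ltW// divr_gt0.
    have : 0 <= g * (x - g^-1) ^+ 2 by rewrite mulr_ge0 ?sqr_ge0// ltW.
    have -> : g * (x - g^-1) ^+ 2 = g * x ^+ 2 - 2 * x + g^-1.
      by field; rewrite gt_eqF.
    by lra.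
  rewrite memNset ?mulr0; last by move=> /=; rewrite leNgt Dx.
  have : 0 <= g * x ^+ 2 by rewrite mulr_ge0 ?sqr_ge0// ltW.
  by have [x0|x0] := leP 0 x; [rewrite ger0_norm//|rewrite ltr0_norm//]; lra.
have bound2 w : S w * S' w <=
    b * `|S w| + (2 * b)^-1 * (S w ^+ 2 + S' w ^+ 4).
  rewrite -(ler_pM2l (mulr_gt0 (ltr0n R 2) b0)) mulrDr mulVKf; last first.
    by rewrite gt_eqF// mulr_gt0.
  have := ler_norm (S w * S' w); rewrite normrM.
  have -> : S' w ^+ 4 = `|S' w| ^+ 4.
    by rewrite -normrX ger0_norm// exprn_even_ge0.
  rewrite -(real_normK (num_real (S w))).
  move: (normr_ge0 (S w)) (normr_ge0 (S' w)).
  set x := `|S w|; set y := `|S' w| => x0 y0 xy.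
  (* [h1] gives x^2 + y^4 >= 2 x y^2; what remains is 2 x times b^2 + y^2 >= b y, which is [h2]. *)
  have h1 : 0 <= (x - y ^+ 2) ^+ 2 by exact: sqr_ge0.
  have h2 : 0 <= 2 * x * (b ^+ 2 + y ^+ 2 - b * y).
    by rewrite mulr_ge0 ?mulr_ge0//; nra.
  have h3 : 2 * b * (S w * S' w) <= 2 * b * (x * y).
    by rewrite ler_pM2l// mulr_gt0.
  by rewrite (le_trans h3)//; nra.
have bound w : S w * S' w <= b * (2 * (D / 8) + g * S w ^+ 2 +
    (g^-1 * \1_[set w | D / 8 <= S w] w + (-1) * S w)) +
    (2 * b)^-1 * (S w ^+ 2 + S' w ^+ 4).
  by rewrite (le_trans (bound2 w))// lerD2r ler_pM2l.
have := has_mean_le SS' H bound; rewrite mulr1 mulr0 addr0 -/p => le1.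
have le2 : (2 * b)^-1 * (1 + q) <= kappa / 2.
  rewrite -(ler_pM2l (mulr_gt0 (ltr0n R 2) b0)) mulVKf; last first.
    by rewrite gt_eqF// mulr_gt0.
  have -> : 2 * b * (kappa / 2) = b * kappa by field.
  by rewrite bE lerD2l.
have le3 : b * D <= b * (2 * (D / 8) + g + g^-1 * p) by rewrite DE; lra.
rewrite ler_pM2l// in le3.
have le4 : D / 2 <= g^-1 * p by rewrite /g in le3 *; lra.
have : g * (D / 2) <= g * (g^-1 * p) by rewrite ler_pM2l.
rewrite mulVKf ?gt_eqF//; apply: le_trans.
by rewrite /g le_eqVlt; apply/orP; left; apply/eqP; field.
Qed.

End tail_bound.

(** * Means under equal and symmetric laws *)

Section laws.
Context {d : measure_display} {T : measurableType d} {R : realType}.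
Variable P : probability T R.

Lemma has_mean_law (U V : T -> R) (psi : R -> R) (a : R) :
  measurable_fun setT U -> measurable_fun setT V -> measurable_fun setT psi ->
  (forall A : set R, measurable A -> P (U @^-1` A) = P (V @^-1` A)) ->
  has_mean P (psi \o U) a -> has_mean P (psi \o V) a.
Proof.
move=> mU mV mpsi UV [iU <-].
pose U' : {RV P >-> R} := HB.pack U (isMeasurableFun.Build _ _ _ _ U mU).
pose V' : {RV P >-> R} := HB.pack V (isMeasurableFun.Build _ _ _ _ V mV).
have eqI (f : R -> \bar R) :
    (\int[distribution P U']_x f x = \int[distribution P V']_x f x)%E.
  by apply: eq_measure_integral => A mA _; exact: UV.
have mpsi' : measurable_fun setT (EFin \o psi) by exact/measurable_EFinP.
have iV : P.-integrable setT (EFin \o (psi \o V)).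
  apply/integrableP; split.
    by apply/measurable_EFinP; exact: measurableT_comp.
  rewrite (_ : integral _ _ _ =
    \int[distribution P V']_x `|(psi x)%:E|)%E; last first.
    by rewrite ge0_integral_distribution//; exact: measurableT_comp.
  rewrite -eqI ge0_integral_distribution//; last exact: measurableT_comp.
  by case/integrableP : iU.
split => //; rewrite /Rintegral; congr fine.
transitivity (\int[distribution P V']_x (psi x)%:E)%E.
  by rewrite integral_distribution.
by rewrite -eqI integral_distribution.
Qed.

(** By symmetry [psi \o U] has the same law as its negative, so its mean is its own opposite;
    domination by [g] ensures that the mean exists. *)
Lemma has_mean_odd (U : T -> R) (psi : R -> R) (g : T -> R) (b : R) :
  measurable_fun setT U -> measurable_fun setT psi -> symmetric_rv P U ->
  (forall x, psi (- x) = - psi x) -> has_mean P g b ->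
  (forall w, `|psi (U w)| <= g w) -> has_mean P (psi \o U) 0.
Proof.
move=> mU mpsi symU psiN gb psig.
have [a ha] : exists a, has_mean P (psi \o U) a.
  have mpU : measurable_fun setT (psi \o U) by exact: measurableT_comp.
  exact: has_mean_dominated mpU gb psig.
have mUN : measurable_fun setT (\- U) by exact: measurable_funN.
have [_ hN] := has_mean_law mU mUN mpsi symU ha.
have [_ hZ] := has_meanZ (-1) ha.
have aN : a = - a.
  rewrite -{1}hN -[RHS]mulN1r -hZ; apply: eq_Rintegral => w _ /=.
  by rewrite psiN mulN1r.
by have -> : 0 = a by lra.
Qed.

(** A finite variance is an equality between extended integrals, centred at a number [m] that is a
    mean only once [U] is known to be integrable. The bound |U - m| <= (U - m)^2 + 1 gives
    integrability for whatever [m] is; symmetry then shows that [m] is 0. *)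
Lemma has_mean_symmetric_variance (U : T -> R) (s : R) :
  measurable_fun setT U -> symmetric_rv P U -> ('V_P[U] = s%:E)%E ->
  has_mean P U 0 /\ has_mean P (fun w => U w ^+ 2) s.
Proof.
move=> mU symU; rewrite /variance unlock unlock.
set m := fine _; move=> Vs.
have hZ : has_mean P (fun w => (U w - m) ^+ 2) s.
  have mZ : measurable_fun setT (fun w => (U w - m) ^+ 2).
    by apply: measurable_funX; exact: measurable_funB.
  have Vs' : (\int[P]_w ((U w - m) ^+ 2)%:E = s%:E)%E by rewrite -Vs.
  split; last by rewrite /Rintegral Vs'.
  apply/integrableP; split; first exact/measurable_EFinP.
  rewrite (eq_integral (fun w => ((U w - m) ^+ 2)%:E)) ?Vs' ?ltry// => w _.
  by rewrite /= ger0_norm// sqr_ge0.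
have hU : has_mean P U 0.
  apply: (has_mean_odd (psi := id) mU _ symU _
    (has_meanD hZ (has_mean_cst P (1 + `|m|)))) => // w /=.
  have := ler_normD (U w - m) m; rewrite subrK.
  have : `|U w - m| <= (U w - m) ^+ 2 + 1.
    rewrite -(real_normK (num_real (U w - m))).
    by have := sqr_ge0 (`|U w - m| - 1); nra.
  by lra.
have m0 : m = 0 by rewrite /m; case: hU.
split => //; apply: (has_mean_eq hZ) => // w.
by rewrite m0 subr0.
Qed.

End laws.

(** * Lower bounds for tails, uniform in the block and the coefficients *)

Section uniform_tail.
Context {d : measure_display} {T : measurableType d} {R : realType}.
Variables (P : probability T R) (Y : nat -> T -> R) (sigma : nat -> R).

(** The functions g_k that build S'. Every bound is stated in units of [sigma k], so that it passes
    to linear combinations with constants free of k. *)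
Definition dual_family (kappa C : R) (g : nat -> R -> R) : Prop :=
  forall k, [/\ measurable_fun setT (g k),
    has_mean P (fun w => g k (Y k w)) 0,
    exists2 m, has_mean P (fun w => Y k w * g k (Y k w)) m &
      kappa * sigma k ^+ 2 <= m,
    exists2 m, has_mean P (fun w => g k (Y k w) ^+ 2) m & m <= sigma k ^+ 2 &
    exists2 m, has_mean P (fun w => g k (Y k w) ^+ 4) m &
      m <= C * (sigma k ^+ 2) ^+ 2].

Hypothesis mY : forall k, measurable_fun setT (Y k).
Hypothesis indepY : mutually_independent P Y.
Hypothesis Y1 : forall k, has_mean P (Y k) 0.
Hypothesis Y2 : forall k, has_mean P (fun w => Y k w ^+ 2) (sigma k ^+ 2).

(** With V the variance of S, the covariance of S and S' is at least kappa V and E[S'^4] is at most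
    C V^2; the normalisation V = 1 leaves only [kappa] and [C]. *)
Lemma dual_family_tail (kappa C D : R) g (N n : nat) (c : nat -> R) :
  0 < kappa -> 3 <= C -> dual_family kappa C g ->
  D = kappa ^+ 2 / (2 * (1 + C)) ->
  \sum_(N <= k < n) c k ^+ 2 * sigma k ^+ 2 = 1 ->
  D ^+ 2 / 8 <= fine (P [set w | D / 8 <= \sum_(N <= k < n) c k * Y k w]).
Proof.
move=> kappa0 C3 gP DE cs1.
have mg k : measurable_fun setT (g k) by case: (gP k).
have g1 k : has_mean P (fun w => g k (Y k w)) 0 by case: (gP k).
have /choice[e eP] : forall k, exists m,
    has_mean P (fun w => Y k w * g k (Y k w)) m /\ kappa * sigma k ^+ 2 <= m.
  by move=> k; case: (gP k) => _ _ [m ? ?] _ _; exists m.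
have /choice[m2 m2P] : forall k, exists m,
    has_mean P (fun w => g k (Y k w) ^+ 2) m /\ m <= sigma k ^+ 2.
  by move=> k; case: (gP k) => _ _ _ [m ? ?] _; exists m.
have /choice[m4 m4P] : forall k, exists m,
    has_mean P (fun w => g k (Y k w) ^+ 4) m /\ m <= C * (sigma k ^+ 2) ^+ 2.
  by move=> k; case: (gP k) => _ _ _ _ [m ? ?]; exists m.
(* Third moments are dominated through |x|^3 <= x^2 + x^4. *)
have /choice[m3 m3P] : forall k, exists m,
    has_mean P (fun w => g k (Y k w) ^+ 3) m.
  move=> k; have [g2 _] := m2P k; have [g4 _] := m4P k.
  apply: (has_mean_dominated _ (has_meanD g2 g4)) => [|w].
    by apply: measurable_funX; exact: measurableT_comp.
  have : `|g k (Y k w) ^+ 3| ^+ 2 = g k (Y k w) ^+ 6.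
    by rewrite real_normK ?num_real// -exprM.
  have := sqr_ge0 (g k (Y k w)); have := normr_ge0 (g k (Y k w)).
  rewrite normrX -(real_normK (num_real (g k (Y k w)))).
  rewrite (_ : g k (Y k w) ^+ 4 = `|g k (Y k w)| ^+ 4); last first.
    by rewrite -normrX ger0_norm// exprn_even_ge0.
  set x := `|_| => x0 _ _.
  have := mulr_ge0 (sqr_ge0 x) (sqr_ge0 (x - 1)).
  have -> : x ^+ 2 * (x - 1) ^+ 2 = x ^+ 4 - 2 * x ^+ 3 + x ^+ 2 by ring.
  have := exprn_ge0 3 x0.
  lra.
have mc u k : measurable_fun setT (u k) ->
    measurable_fun setT (fun x : R => c k * u k x).
  by move=> mu; exact: measurable_funM.
have mf k := mc (fun=> id) k (@measurable_id _ _ _).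
have mcg k := mc g k (mg k).
have f1 k : has_mean P (fun w => c k * Y k w) 0.
  by apply: (has_mean_eq (has_meanZ (c k) (Y1 k))) => //; rewrite mulr0.
have cg1 k : has_mean P (fun w => c k * g k (Y k w)) 0.
  by apply: (has_mean_eq (has_meanZ (c k) (g1 k))) => //; rewrite mulr0.
have f2 k : has_mean P (fun w => (c k * Y k w) * (c k * Y k w))
    (c k ^+ 2 * sigma k ^+ 2).
  by apply: (has_mean_eq (has_meanZ (c k ^+ 2) (Y2 k))) => // w /=; ring.
have fg k : has_mean P (fun w => (c k * Y k w) * (c k * g k (Y k w)))
    (c k ^+ 2 * e k).
  apply: (has_mean_eq (has_meanZ (c k ^+ 2) (eP k).1)) => // w /=; ring.
have cg2 k : has_mean P (fun w => (c k * g k (Y k w)) ^+ 2)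
    (c k ^+ 2 * m2 k).
  apply: (has_mean_eq (has_meanZ (c k ^+ 2) (m2P k).1)) => // w.
  by rewrite exprMn.
have cg3 k : has_mean P (fun w => (c k * g k (Y k w)) ^+ 3)
    (c k ^+ 3 * m3 k).
  by apply: (has_mean_eq (has_meanZ (c k ^+ 3) (m3P k))) => // w;
    rewrite exprMn.
have cg4 k : has_mean P (fun w => (c k * g k (Y k w)) ^+ 4)
    (c k ^+ 4 * m4 k).
  apply: (has_mean_eq (has_meanZ (c k ^+ 4) (m4P k).1)) => // w.
  by rewrite exprMn.
have S1 := has_mean_sum (Y := Y) (f := fun k x => c k * x) N n f1.
have S2 := has_mean_sum_mul_sum mY indepY N n mf mf f1 f1 f2.
have SS' := has_mean_sum_mul_sum mY indepY N n mf mcg f1 cg1 fg.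
have [|k|q S4 qC] := has_mean_sum_pow4 mY indepY
  (s := fun k => c k ^+ 2 * sigma k ^+ 2) N n C3 mcg cg1 cg2 cg3 cg4.
- by move=> k; rewrite ler_wpM2l ?sqr_ge0//; case: (m2P k).
- rewrite exprMn -exprM mulrCA ler_wpM2l ?exprn_even_ge0//.
  by case: (m4P k).
apply: (tail_lower_bound S1 _ SS' S4 kappa0 _ _ _ DE).
- by rewrite -cs1; apply: (has_mean_eq S2).
- rewrite -[kappa]mulr1 -cs1 mulr_sumr ler_sum// => k _.
  by rewrite mulrCA ler_wpM2l ?sqr_ge0//; case: (eP k).
- by rewrite (lt_le_trans _ C3).
- by move: qC; rewrite cs1 expr1n mulr1.
Qed.

(** In units of the standard deviation [r] of the block, the threshold is at most [D / 8], so the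
    half space contains the event of [dual_family_tail]. If the variance is 0, all coefficients of
    the block vanish and the half space is the whole space, whence the [1] in the minimum. *)
Lemma dual_family_half_space (kappa C D : R) g (N n : nat)
    (c alpha : nat -> R) :
  (forall k, 0 < sigma k) ->
  0 < kappa -> 3 <= C -> dual_family kappa C g ->
  D = kappa ^+ 2 / (2 * (1 + C)) ->
  \sum_(N <= k < n) alpha k ^+ 2 / sigma k ^+ 2 <= (D / 8) ^+ 2 ->
  Num.min 1 (D ^+ 2 / 8) <= fine (P [set w | \sum_(N <= k < n) c k * alpha k <=
                                  \sum_(N <= k < n) c k * Y k w]).
Proof.
move=> s0 kappa0 C3 gP DE alphaD.
have D0 : 0 < D / 8.
  rewrite DE !divr_gt0// ?exprn_gt0// mulr_gt0// addr_gt0//.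
  by rewrite (lt_le_trans _ C3).
pose V := \sum_(N <= k < n) c k ^+ 2 * sigma k ^+ 2.
have V0 : 0 <= V by apply: sumr_ge0 => k _; rewrite mulr_ge0// sqr_ge0.
have [V1|] := eqVneq V 0.
  have c0 k : (N <= k < n)%N -> c k = 0.
    move=> kNn; have : c k ^+ 2 * sigma k ^+ 2 == 0.
      move/eqP : V1; rewrite /V big_seq psumr_eq0; last first.
        by move=> j _; rewrite mulr_ge0// sqr_ge0.
      by move/allP/(_ k); rewrite mem_index_iota kNn => /(_ isT) /implyP; apply.
    by rewrite mulf_eq0 !sqrf_eq0 (gt_eqF (s0 k)) orbF => /eqP.
  rewrite (_ : [set w | _] = setT) ?probability_setT ?ge_min ?lexx//.
  apply/seteqP; split=> w //= _.
  by rewrite big_nat [leRHS]big_nat !big1// => k /c0 ->; rewrite mul0r.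
rewrite -[V]sqr_sqrtr// sqrf_eq0 => r0; set r := Num.sqrt V in r0.
have {}r0 : 0 < r by rewrite lt_def r0 sqrtr_ge0.
have rV : r ^+ 2 = V by rewrite sqr_sqrtr.
have cr1 : \sum_(N <= k < n) (c k / r) ^+ 2 * sigma k ^+ 2 = 1.
  under eq_bigr do rewrite expr_div_n mulrAC.
  by rewrite -mulr_suml -/V -rV divff// expf_neq0// gt_eqF.
have crY w : \sum_(N <= k < n) c k / r * Y k w =
    (\sum_(N <= k < n) c k * Y k w) / r.
  by rewrite mulr_suml; apply: eq_bigr => k _; rewrite mulrAC.
have cralpha : (\sum_(N <= k < n) c k * alpha k) / r <= D / 8.
  have -> : (\sum_(N <= k < n) c k * alpha k) / r =
      \sum_(N <= k < n) (c k / r) * alpha k.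
    by rewrite mulr_suml; apply: eq_bigr => k _; rewrite mulrAC.
  (* AM-GM: [2 x y <= (D/8) x^2 + y^2 / (D/8)] with [x = c sigma / r] and
     [y = alpha / sigma]. *)
  apply: (@le_trans _ _ (\sum_(N <= k < n)
      (D / 8 / 2 * ((c k / r) ^+ 2 * sigma k ^+ 2) +
       (D / 8)^-1 / 2 * (alpha k ^+ 2 / sigma k ^+ 2)))).
    apply: ler_sum => k _.
    have sk := s0 k.
    pose z := c k / r * sigma k - (D / 8)^-1 * (alpha k / sigma k).
    have := mulr_ge0 (ltW D0) (sqr_ge0 z); rewrite /z.
    have -> : D / 8 *
        (c k / r * sigma k - (D / 8)^-1 * (alpha k / sigma k)) ^+ 2 =
        2 * (D / 8 / 2 * ((c k / r) ^+ 2 * sigma k ^+ 2) +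
             (D / 8)^-1 / 2 * (alpha k ^+ 2 / sigma k ^+ 2)) -
        2 * (c k / r * alpha k).
      have Dn : D != 0 by apply: contraTneq D0 => ->; rewrite mul0r ltxx.
      by field; rewrite Dn !gt_eqF.
    by lra.
  rewrite big_split/= -!mulr_sumr cr1 mulr1.
  have : (D / 8)^-1 / 2 * \sum_(N <= k < n) alpha k ^+ 2 / sigma k ^+ 2 <=
      (D / 8)^-1 / 2 * (D / 8) ^+ 2.
    by rewrite ler_wpM2l// ltW// divr_gt0// invr_gt0.
  have -> : (D / 8)^-1 / 2 * (D / 8) ^+ 2 = D / 8 / 2.
    by rewrite expr2 mulrAC mulKf// gt_eqF.
  by lra.
rewrite ge_min; apply/orP; right.
apply: le_trans (dual_family_tail kappa0 C3 gP DE cr1) _.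
have mS (b : R) : measurable [set w | b <= \sum_(N <= k < n) c k * Y k w].
  apply: measurable_superlevel.
  by apply: measurable_sum => k; exact: measurable_funM.
have -> : [set w | D / 8 <= \sum_(N <= k < n) c k / r * Y k w] =
    [set w | D / 8 * r <= \sum_(N <= k < n) c k * Y k w].
  by apply/seteqP; split=> w /=; rewrite crY ler_pdivlMr.
apply: fine_le; [exact: fin_num_measure|exact: fin_num_measure|].
apply: le_measure; rewrite ?inE// => w /=.
by apply: le_trans; rewrite -ler_pdivrMr.
Qed.

End uniform_tail.

(** * Summability and uniform lower bounds for half spaces *)

Lemma summable_tail (R : realType) (u : nat -> R) (e : R) :
  (forall k, 0 <= u k) -> 0 < e ->
  (\sum_(0 <= k <oo) (u k)%:E < +oo)%E ->
  exists2 N, (0 < N)%N & forall n, \sum_(N <= k < n) u k <= e.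
Proof.
move=> u0 e0 uoo.
pose V n := \sum_(0 <= k < n) u k.
have Vub n : V n <= fine (\sum_(0 <= k <oo) (u k)%:E)%E.
  rewrite -lee_fin fineK; last first.
    by rewrite ge0_fin_numE// nneseries_ge0// => k _ _; rewrite lee_fin.
  by rewrite -sumEFin; apply: nneseries_lim_ge => k _ _; rewrite lee_fin.
have supV : has_sup (range V).
  split; first by exists (V 0%N), 0%N.
  by eexists => _ [n _ <-]; exact: Vub.
have [_ [N _ <-] supN] := sup_adherent e0 supV.
(* The successor makes the cut positive, as the dimension in (A-I) has to be; the skipped term [u N]
   is nonnegative. *)
exists N.+1 => // n; have [Nn|nN] := leqP N.+1 n; last first.
  by rewrite big_geq ?ltW// ltnW.
have Vn : V n <= sup (range V) by apply: ub_le_sup; [case: supV|exists n].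
have VE : V n = V N + u N + \sum_(N.+1 <= k < n) u k.
  by rewrite /V -(@big_nat_recr _ _ _ N)//= -big_cat_nat.
by have := u0 N; move: supN; lra.
Qed.

Section half_spaces.
Context {d : measure_display} {T : measurableType d} {R : realType}.
Variables (P : probability T R) (Y : nat -> T -> R) (sigma alpha : nat -> R).
Hypothesis mY : forall k, measurable_fun setT (Y k).
Hypothesis indepY : mutually_independent P Y.
Hypothesis Y1 : forall k, has_mean P (Y k) 0.
Hypothesis Y2 : forall k, has_mean P (fun w => Y k w ^+ 2) (sigma k ^+ 2).
Hypothesis sigma_gt0 : forall k, 0 < sigma k.

Let half_space (c : nat -> R) N n :=
  [set w | \sum_(N <= k < n) c k * alpha k <= \sum_(N <= k < n) c k * Y k w].

Let measurable_half_space c N n : measurable (half_space c N n).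
Proof.
apply: measurable_superlevel.
by apply: measurable_sum => k; exact: measurable_funM.
Qed.

Lemma half_space_lower_bound_summable (h : R) : 0 < h ->
  (forall n c, h <= fine (P (half_space c 0 n))) ->
  (\sum_(0 <= k <oo) (alpha k ^+ 2 / sigma k ^+ 2)%:E < +oo)%E.
Proof.
move=> h0 hP; apply: (@le_lt_trans _ _ (h^-1)%:E); last exact: ltry.
have s20 k : sigma k ^+ 2 != 0 by rewrite sqrf_eq0 gt_eqF.
have a0 k : 0 <= alpha k ^+ 2 / sigma k ^+ 2 by rewrite divr_ge0// sqr_ge0.
apply: lime_le.
  by apply: is_cvg_nneseries => k _ _; rewrite lee_fin.
near=> n; rewrite sumEFin lee_fin.
set V := \sum_(_ <= _ < _) _.
have V0 : 0 <= V by exact: sumr_ge0.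
(* These weights make the threshold and the variance of the sum the same number [V], so Chebyshev
   reads V^2 h <= V. *)
pose c k := alpha k / sigma k ^+ 2.
have mc k : measurable_fun setT (fun x : R => c k * x).
  exact: measurable_funM.
have c1 k : has_mean P (fun w => c k * Y k w) 0.
  by apply: (has_mean_eq (has_meanZ (c k) (Y1 k))) => //; rewrite mulr0.
have c2 k : has_mean P (fun w => (c k * Y k w) * (c k * Y k w))
    (alpha k ^+ 2 / sigma k ^+ 2).
  apply: (has_mean_eq (has_meanZ (c k ^+ 2) (Y2 k))) => [w|]; first by ring.
  by rewrite /c; field; rewrite gt_eqF.
have S2 := has_mean_sum_mul_sum mY indepY 0 n mc mc c1 c1 c2.
have VE : \sum_(0 <= k < n) c k * alpha k = V.
  by apply: eq_bigr => k _; rewrite /c mulrAC.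
have := has_mean_le (has_meanZ (V ^+ 2)
  (has_mean_indic P (measurable_half_space c 0 n))) S2.
have /[swap] /[apply] : forall w, V ^+ 2 * \1_(half_space c 0 n) w <=
    (\sum_(0 <= k < n) c k * Y k w) * (\sum_(0 <= k < n) c k * Y k w).
  move=> w; rewrite indicE; have [|_] := boolP (w \in _).
    rewrite inE /half_space /= VE mulr1 -expr2 => VS.
    by rewrite lerXn2r// nnegrE (le_trans V0).
  by rewrite mulr0 -expr2 sqr_ge0.
rewrite -/V => VP.
have [->|Vn0] := eqVneq V 0; first by rewrite invr_ge0 ltW.
have Vgt0 : 0 < V by rewrite lt_def Vn0.
rewrite -[leRHS]mul1r ler_pdivlMr//.
rewrite -(ler_pM2l Vgt0) mulr1 mulrA -expr2 (le_trans _ VP)//.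
by rewrite ler_wpM2l ?sqr_ge0.
Unshelve. all: by end_near. Qed.

(** The level [D / 8] depends on [kappa] and [C] only, so the cut [N] is fixed before any half space
    is given, and [head] is needed at this single [N]. *)
Lemma summable_half_space_lower_bound (kappa C : R) g :
  0 < kappa -> 3 <= C -> dual_family P Y sigma kappa C g ->
  (forall N, (0 < N)%N -> exists2 h, 0 < h &
     forall c, h <= fine (P (half_space c 0 N))) ->
  (\sum_(0 <= k <oo) (alpha k ^+ 2 / sigma k ^+ 2)%:E < +oo)%E ->
  exists2 h, 0 < h & forall n c, h <= fine (P (half_space c 0 n)).
Proof.
move=> kappa0 C3 gP head summable.
pose D := kappa ^+ 2 / (2 * (1 + C)).
have D0 : 0 < D.
  by rewrite divr_gt0// ?exprn_gt0// mulr_gt0// addr_gt0// (lt_le_trans _ C3).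
have a0 k : 0 <= alpha k ^+ 2 / sigma k ^+ 2 by rewrite divr_ge0// sqr_ge0.
have eta0 : 0 < (D / 8) ^+ 2 by rewrite exprn_gt0// divr_gt0.
have [N N0 tailN] := summable_tail a0 eta0 summable.
have [h h0 hP] := head N N0.
pose delta := Num.min 1 (D ^+ 2 / 8).
have delta0 : 0 < delta by rewrite lt_min ltr01 divr_gt0// exprn_gt0.
exists (h * delta); first exact: mulr_gt0.
(* Padding the coefficients by 0 up to [maxn n N] gives every half space a head of exactly [N]
   terms, even when [n] is smaller than [N]. *)
move=> n c0; pose c k := if (k < n)%N then c0 k else 0.
pose m := maxn n N.
have pad (v : nat -> R) : \sum_(0 <= k < n) c0 k * v k =
    \sum_(0 <= k < N) c k * v k + \sum_(N <= k < m) c k * v k.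
  rewrite -big_cat_nat ?leq_maxr//= (@big_cat_nat _ _ _ n 0 m)//= ?leq_maxl//.
  rewrite [X in _ = _ + X]big_nat [X in _ = _ + X]big1 ?addr0; last first.
    by move=> k /andP[nk _]; rewrite /c ltnNge nk mul0r.
  by apply: eq_big_nat => k /andP[_ kn]; rewrite /c kn.
have uI : uniq (index_iota 0 N ++ index_iota N m).
  rewrite /index_iota subn0.
  by rewrite -{2}[N]add0n -iotaD iota_uniq.
have mid (k : nat) : measurable_fun setT (fun x : R => c k * x).
  exact: measurable_funM.
have ind := independent_rv2_sum mY indepY mid mid uI.
have mI (b : R) : measurable [set x : R | b <= x].
  exact: measurable_superlevel.
have PHT : fine (P (half_space c 0 N `&` half_space c N m)) =
    fine (P (half_space c 0 N)) * fine (P (half_space c N m)).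
  rewrite -fineM; [|exact: fin_num_measure..].
  by congr fine; exact: (ind _ _ (mI _) (mI _)).
apply: (@le_trans _ _ (fine (P (half_space c 0 N `&` half_space c N m)))).
  rewrite PHT; apply: ler_pM; [exact: ltW|exact: ltW|exact: hP|].
  exact: (dual_family_half_space mY indepY Y1 Y2 c sigma_gt0 kappa0 C3 gP
    erefl (tailN m)).
apply: fine_le; [exact/fin_num_measure/measurableI|exact: fin_num_measure|].
apply: le_measure; rewrite ?inE//; first exact: measurableI.
by move=> w [/= H1 H2]; rewrite /half_space/= !pad lerD.
Qed.

End half_spaces.

(** * Dual families under (A-II) and (A-III) *)

Section conditions_imply_dual_family.
Context {d : measure_display} {T : measurableType d} {R : realType}.
Variables (P : probability T R) (Y : nat -> T -> R) (sigma : nat -> R).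
Hypothesis mY : forall k, measurable_fun setT (Y k).
Hypothesis symY : forall k, symmetric_rv P (Y k).
Hypothesis Y1 : forall k, has_mean P (Y k) 0.
Hypothesis Y2 : forall k, has_mean P (fun w => Y k w ^+ 2) (sigma k ^+ 2).
Hypothesis sigma_gt0 : forall k, 0 < sigma k.

(** For the identity the covariance is the variance itself, hence [kappa] = 1. The 3 in the maximum
    is what [has_mean_sum_pow4] demands. *)
Lemma dual_family_id (c : R) :
  (forall k, 'E_P[fun w => (Y k w ^+ 4)%R] <=
     c%:E * 'E_P[fun w => (Y k w ^+ 2)%R] ^+ 2)%E ->
  dual_family P Y sigma 1 (Num.max 3 c) (fun=> id).
Proof.
move=> Y4 k; have := Y4 k; rewrite unlock => {}Y4.
have E2 : (\int[P]_w (Y k w ^+ 2)%:E)%E = (sigma k ^+ 2)%:E.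
  case: (Y2 k) => i <-; rewrite fineK//; exact: integrable_fin_num i.
rewrite E2 -EFin_expe -EFinM in Y4.
have m4 : measurable_fun setT (fun w => Y k w ^+ 4) by exact: measurable_funX.
have i4 : P.-integrable setT (EFin \o (fun w => Y k w ^+ 4)).
  apply/integrableP; split; first exact/measurable_EFinP.
  rewrite (eq_integral (fun w => (Y k w ^+ 4)%:E)).
    by rewrite (le_lt_trans Y4) ?ltry.
  move=> w _.
  by rewrite /= ger0_norm// exprn_even_ge0.
split => //.
- by exists (sigma k ^+ 2); [exact: Y2|rewrite mul1r].
- by exists (sigma k ^+ 2).
- exists (\int[P]_w (Y k w ^+ 4)); first by split.
  rewrite -lee_fin fineK; last exact: integrable_fin_num i4.
  by rewrite (le_trans Y4)// lee_fin ler_wpM2r ?sqr_ge0// le_max lexx orbT.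
Qed.

(* A bounded odd function with [x * shrink x > 0] off [0]. *)
Let shrink (x : R) : R := x / (1 + x ^+ 2).

Let onesqr_gt0 (x : R) : 0 < 1 + x ^+ 2.
Proof. by rewrite ltr_pwDl// sqr_ge0. Qed.

Let measurable_shrink : measurable_fun setT shrink.
Proof.
apply: measurable_funM => //; apply: continuous_measurable_fun => x.
apply: cvgV; first by rewrite gt_eqF.
by apply: cvgD; [exact: cvg_cst|exact: exprn_continuous].
Qed.

Let shrinkN x : shrink (- x) = - shrink x.
Proof. by rewrite /shrink sqrrN mulNr. Qed.

Let shrink_le1 x : `|shrink x| <= 1.
Proof.
rewrite /shrink normrM normfV (ger0_norm (ltW (onesqr_gt0 x))).
rewrite ler_pdivrMr// mul1r -(real_normK (num_real x)).
by have := sqr_ge0 (`|x| - 1); have := normr_ge0 x; nra.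
Qed.

Let shrink2_le x : shrink x ^+ 2 <= x ^+ 2.
Proof.
rewrite /shrink expr_div_n ler_pdivrMr ?exprn_gt0// ler_peMr ?sqr_ge0//.
by rewrite exprn_ege1// lerDl sqr_ge0.
Qed.

Let has_mean_bounded (f : R -> R) (U : T -> R) (b : R) :
  measurable_fun setT f -> measurable_fun setT U -> (forall x, `|f x| <= b) ->
  exists m, has_mean P (f \o U) m.
Proof.
move=> mf mU fb; apply: (has_mean_dominated _ (has_mean_cst P b)) => [|w].
  exact: measurableT_comp.
exact: fb.
Qed.

Let mulshrink_le1 x : `|x * shrink x| <= 1.
Proof.
rewrite /shrink mulrA -expr2 ger0_norm; last by rewrite divr_ge0 ?sqr_ge0// ltW.
by rewrite ler_pdivrMr// mul1r lerDr.
Qed.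

(** A nonnegative integrand of mean 0 vanishes almost everywhere; here this would force U = 0 almost
    everywhere, against [0 < m2]. *)
Let mulshrink_gt0 (U : T -> R) (m2 m : R) : measurable_fun setT U ->
  has_mean P (fun w => U w ^+ 2) m2 -> 0 < m2 ->
  has_mean P (fun w => U w * shrink (U w)) m -> 0 < m.
Proof.
move=> mU [i2 U2] m20 [im Um].
have ge0 w : 0 <= U w * shrink (U w).
  by rewrite /shrink mulrA -expr2 divr_ge0 ?sqr_ge0// ltW.
rewrite lt_def -{2}Um Rintegral_ge0// andbT; apply/eqP => m0.
have mf : measurable_fun setT (EFin \o (fun w => U w * shrink (U w))).
  exact: measurable_int im.
have : (\int[P]_w `|(U w * shrink (U w))%:E| = 0)%E.
  under eq_integral => w _ do rewrite gee0_abs ?lee_fin//.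
  by rewrite -(fineK (integrable_fin_num _ im))//; congr EFin; rewrite -m0 -Um.
move/(ae_eq_integral_abs P measurableT mf) => ae0.
have : (\int[P]_w `|(U w ^+ 2)%:E| = 0)%E.
  apply/(ae_eq_integral_abs P measurableT (measurable_int P i2)).
  apply: filterS ae0 => w /(_ I) /= [/eqP]; rewrite mulf_eq0 => U0 _.
  suff -> : U w = 0 by rewrite expr0n.
  move: U0; rewrite /shrink mulf_eq0 invr_eq0 (gt_eqF (onesqr_gt0 _)) orbF.
  by rewrite orbb => /eqP.
under eq_integral => w _ do rewrite gee0_abs ?lee_fin ?sqr_ge0//.
move=> U20; move: m20; rewrite -U2 /Rintegral U20 ltxx//.
Qed.

(** Shrinking [Y k] in units of [lambda k] reduces each moment to one of [Z 0], times a power of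
    [lambda k]. As [sigma k] is the same multiple of [lambda k] for all k, the bounds are
    uniform. *)
Lemma dual_family_identically_distributed (lambda : nat -> R) :
  (forall k, 0 < lambda k) ->
  identically_distributed P (fun k w => Y k w / lambda k) ->
  exists kappa C g, [/\ 0 < kappa, 3 <= C & dual_family P Y sigma kappa C g].
Proof.
move=> l0 id.
have ln0 k : lambda k != 0 by rewrite gt_eqF.
pose Z k w := Y k w / lambda k.
have mZ k : measurable_fun setT (Z k) by exact: measurable_funM.
have law (f : R -> R) m k : measurable_fun setT f ->
    has_mean P (f \o Z 0%N) m -> has_mean P (f \o Z k) m.
  by move=> mf; apply: has_mean_law => // A mA; exact: id.
pose s := sigma 0%N ^+ 2 / lambda 0%N ^+ 2.
have s0 : 0 < s by rewrite divr_gt0// exprn_gt0.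
have ZY k : has_mean P (fun w => Z k w ^+ 2) (sigma k ^+ 2 / lambda k ^+ 2).
  apply: (has_mean_eq (has_meanZ (lambda k ^- 2) (Y2 k))) => [w|];
    last by rewrite mulrC.
  by rewrite /Z expr_div_n mulrC.
have Zs k : has_mean P (fun w => Z k w ^+ 2) s.
  by apply: (law (fun x => x ^+ 2)); [exact: measurable_funX|exact: ZY].
have sE k : sigma k ^+ 2 = lambda k ^+ 2 * s.
  have [_ h1] := ZY k; have [_ h2] := Zs k.
  by rewrite -h2 h1; field.
have mms : measurable_fun setT (fun x : R => x * shrink x).
  exact: measurable_funM.
have [tau hm] := has_mean_bounded mms (mZ 0%N) mulshrink_le1.
have tau0 := mulshrink_gt0 (mZ 0%N) (Zs 0%N) s0 hm.
have [a ha] : exists a, has_mean P (fun w => shrink (Z 0%N w) ^+ 2) a.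
  apply: (has_mean_bounded (f := fun x => shrink x ^+ 2) (b := 1)) => //.
    exact: measurable_funX.
  by move=> x; rewrite normrX exprn_ile1.
have [b hb] : exists b, has_mean P (fun w => shrink (Z 0%N w) ^+ 4) b.
  apply: (has_mean_bounded (f := fun x => shrink x ^+ 4) (b := 1)) => //.
    exact: measurable_funX.
  by move=> x; rewrite normrX exprn_ile1.
(* Here [tau] = E[Z shrink(Z)], [b] = E[shrink(Z)^4] and [s] = E[Z^2]; dividing by [s] and [s ^+ 2]
   converts units of [lambda k] into units of [sigma k]. *)
exists (tau / s), (Num.max 3 (b / s ^+ 2)).
exists (fun k y => lambda k * shrink (y / lambda k)).
split; [exact: divr_gt0|by rewrite le_max lexx|move=> k].
have mg : measurable_fun setT (fun y : R => lambda k * shrink (y / lambda k)).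
  apply: measurable_funM => //.
  by apply: (measurableT_comp measurable_shrink); exact: measurable_funM.
split => //.
- apply: (has_mean_odd (psi := fun y => lambda k * shrink (y / lambda k))
    (mY k) mg (@symY k) _ (has_mean_cst P (lambda k))) => [x|w].
    by rewrite mulNr shrinkN mulrN.
  by rewrite normrM gtr0_norm// ler_piMr// ltW.
- exists (lambda k ^+ 2 * tau); last by rewrite sE mulrCA divfK// gt_eqF.
  apply: (has_mean_eq (has_meanZ (lambda k ^+ 2)
    (law _ _ k mms hm))) => // w /=.
  by rewrite /Z; field.
- exists (lambda k ^+ 2 * a).
    apply: (has_mean_eq (has_meanZ (lambda k ^+ 2)
      (law (fun x => shrink x ^+ 2) _ k _ ha))) => //;
      first exact: measurable_funX.
    by move=> w; rewrite [RHS]exprMn.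
  rewrite sE ler_wpM2l ?sqr_ge0//.
  by apply: (has_mean_le ha (Zs 0%N)) => w; exact: shrink2_le.
- exists (lambda k ^+ 4 * b).
    apply: (has_mean_eq (has_meanZ (lambda k ^+ 4)
      (law (fun x => shrink x ^+ 4) _ k _ hb))) => //;
      first exact: measurable_funX.
    by move=> w; rewrite [RHS]exprMn.
  have -> : (sigma k ^+ 2) ^+ 2 = lambda k ^+ 4 * s ^+ 2.
    by rewrite sE; ring.
  rewrite mulrCA ler_wpM2l ?exprn_even_ge0//.
  by rewrite -ler_pdivrMr ?exprn_gt0// le_max lexx orbT.
Qed.

End conditions_imply_dual_family.

(** * Heads under (A-III): rays and orthants *)

Lemma density_upper_tail_gt0 (d : measure_display) (T : measurableType d)
    (R : realType) (P : probability T R) (U : T -> R) (phi : R -> R) (x : R) :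
  has_density P U phi -> {ae lebesgue_measure, forall y, 0 < phi y} ->
  (0 < P (U @^-1` `[x, +oo[))%E.
Proof.
move=> [mphi phi0 Uphi] phipos.
rewrite lt0e measure_ge0 andbT; apply/eqP.
rewrite Uphi//= => /eqP; apply/negP/eqP => int0.
pose D : set R := `[x, +oo[%classic.
have mD : measurable D by exact: measurable_itv.
have mphiD : measurable_fun D (EFin \o phi).
  by apply/measurable_EFinP; exact: measurable_funTS.
have : (\int[lebesgue_measure]_(y in D) `|(EFin \o phi) y| = 0)%E.
  by rewrite -[RHS]int0; apply: eq_integral => y _; rewrite gee0_abs// lee_fin.
move/(ae_eq_integral_abs lebesgue_measure mD mphiD) => ae0.
(* On the ray [phi] would be both zero and positive almost everywhere, making the ray null although
   its length is infinite. *)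
have : lebesgue_measure.-negligible D.
  have [N [mN N0 subN]] := filterI ae0 phipos.
  exists N; split => // y Dy; apply: subN => /= -[/(_ Dy) [->]].
  by rewrite ltxx.
move/(negligibleP lebesgue_measure mD); rewrite /= lebesgue_measure_itv/= ltry.
by rewrite addye.
Qed.

(** The lower bound is free of [c]: the signs of the coefficients only select an orthant, and by
    symmetry and independence all these orthants have the same probability. *)
Lemma symmetric_half_space_lower_bound (d : measure_display)
    (T : measurableType d) (R : realType) (P : probability T R)
    (Y : nat -> T -> R) (alpha c : nat -> R) (n : nat) :
  (forall k, measurable_fun setT (Y k)) ->
  mutually_independent P Y -> (forall k, symmetric_rv P (Y k)) ->
  \prod_(0 <= k < n) fine (P (Y k @^-1` `[`|alpha k|, +oo[)) <=
  fine (P [set w | \sum_(0 <= k < n) c k * alpha k <=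
                   \sum_(0 <= k < n) c k * Y k w]).
Proof.
move=> mY indepY symY.
have mH : measurable [set w | \sum_(0 <= k < n) c k * alpha k <=
                              \sum_(0 <= k < n) c k * Y k w].
  apply: measurable_superlevel.
  by apply: measurable_sum => k; exact: measurable_funM.
pose A k : set R := if 0 <= c k then `[`|alpha k|, +oo[%classic
                    else `]-oo, - `|alpha k|]%classic.
have mA k : measurable (A k) by rewrite /A; case: ifP.
have mYA k (B : set R) : measurable B -> measurable (Y k @^-1` B).
  by move=> mB; rewrite -[X in measurable X]setTI; exact: mY.
have PA k : P (Y k @^-1` A k) = (fine (P (Y k @^-1` `[`|alpha k|, +oo[)))%:E.
  rewrite fineK; last by apply: fin_num_measure; exact: mYA.
  rewrite /A; case: ifP => // _; rewrite symY//; congr (P _).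
  by apply/seteqP; split=> w /=; rewrite !in_itv/= andbT lerN2.
have H := indepY (index_iota 0 n) A (iota_uniq _ _) mA.
rewrite (eq_bigr _ (fun k _ => PA k)) prodEFin in H.
rewrite -lee_fin -H fineK; last exact: fin_num_measure.
apply: le_measure; rewrite ?inE//.
  by apply: fin_bigcap_measurable => // k _; exact: mYA.
move=> w /= HA; rewrite big_nat [leRHS]big_nat; apply: ler_sum => k kn.
have := HA k; rewrite /= mem_index_iota => /(_ kn).
have := ler_norm (alpha k); have := ler_normr (- `|alpha k|) (alpha k).
rewrite /A; case: ifPn => [c0|]; rewrite /= in_itv/= ?andbT => *.
  by rewrite ler_wpM2l//; lra.
rewrite ler_wnM2l//; last by have := lerNnormlW (lexx `|alpha k|); lra.
by rewrite ltW// ltNge.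
Qed.

(** * From depths to uniform bounds on probabilities *)

Lemma half_space_depth_gt0P (d : measure_display) (T : measurableType d)
    (R : realType) (mu : probability T R) (F : set (T -> R)) (a : T) :
  F !=set0 -> (forall s, F s -> measurable_fun setT s) ->
  (0 < half_space_depth F a mu)%E <->
  exists2 h : R, 0 < h & forall s, F s -> h <= fine (mu [set x | s a <= s x]).
Proof.
move=> [s0 Fs0] mF.
have mH s : F s -> measurable [set x | s a <= s x].
  by move=> Fs; exact/measurable_superlevel/mF.
have le s : F s -> (half_space_depth F a mu <= mu [set x | (s a <= s x)%R])%E.
  by move=> Fs; apply: ereal_inf_lbound; exists s.
split=> [dpos|[h h0 hF]]; last first.
  apply: (@lt_le_trans _ _ h%:E); first by rewrite lte_fin.
  apply: le_ereal_inf_tmp => _ [s Fs <-].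
  rewrite -[leRHS]fineK; first by rewrite lee_fin hF.
  exact/fin_num_measure/mH.
(* Here [F] must be nonempty: the infimum of the empty set is [+oo], which [fine] would turn into
   0. *)
have dfin : half_space_depth F a mu \is a fin_num.
  rewrite ge0_fin_numE; last exact: ltW.
  rewrite (le_lt_trans (le _ Fs0))//.
  by rewrite (le_lt_trans (probability_le1 _ (mH _ Fs0)))// ltry.
exists (fine (half_space_depth F a mu)).
  by apply: fine_gt0; rewrite dpos -ge0_fin_numE ?dfin// ltW.
move=> s Fs; apply: fine_le => //; last exact: le.
exact/fin_num_measure/mH.
Qed.

Lemma half_space_depth_linear_combinations_gt0P (d d' : measure_display)
    (Omega : measurableType d) (T : measurableType d') (R : realType)
    (P : probability Omega R) (X : {RV P >-> T})
    (t : nat -> {mfun T >-> R}) (a : T) :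
  (0 < half_space_depth (linear_combinations t) a (distribution P X))%E <->
  exists2 h : R, 0 < h & forall n (c : nat -> R),
    h <= fine (P [set w | \sum_(0 <= k < n) c k * t k a <=
                          \sum_(0 <= k < n) c k * t k (X w)]).
Proof.
have mlin s : linear_combinations t s -> measurable_fun setT s.
  move=> [n [c ->]]; apply: measurable_sum => k; exact: measurable_funM.
have lin0 : linear_combinations t !=set0.
  by exists (fun x => \sum_(k < 0) 0 * t k x); exists 0%N, (fun=> 0).
rewrite (half_space_depth_gt0P _ _ lin0 mlin).
split=> -[h h0 hP]; exists h => //.
- move=> n c; have := hP (fun x => \sum_(k < n) c k * t k x).
  rewrite big_mkord /distribution /pushforward /=.
  under [X in fine (P X)]eq_set do rewrite big_mkord.
  by apply; exists n, (fun k => c k).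
- move=> _ [n [c ->]].
  (* Extends the coefficients by 0 to a sequence, so that one family can be cut at any index. *)
  pose c' k := oapp c 0 (insub k).
  have sumE (v : nat -> R) :
      \sum_(0 <= k < n) c' k * v k = \sum_(k < n) c k * v k.
    rewrite big_mkord; apply: eq_bigr => k _.
    by rewrite /c' -[nat_of_ord k]/(val k) valK.
  have := hP n c'; congr (_ <= fine (P _)).
  by apply/seteqP; split=> w /=; rewrite !sumE.
Qed.

(** A combination of the first [n] functionals factors through the coordinate map as a linear
    functional on R^n, so the Tukey depth in dimension [n] bounds the half spaces for all [c] at
    once. *)
Lemma condition_AI_half_space_lower_bound (d : measure_display)
    (Omega : measurableType d) (R : realType) (P : probability Omega R)
    (B : topologicalLmodType R) (X : {RV P >-> borel B})
    (t : nat -> {mfun borel B >-> R}) (a : B) (n : nat) :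
  condition_AI X t -> (0 < n)%N ->
  exists2 h : R, 0 < h & forall c : nat -> R,
    h <= fine (P [set w | \sum_(0 <= k < n) c k * t k a <=
                          \sum_(0 <= k < n) c k * t k (X w)]).
Proof.
move=> AI n0; have := AI a n n0; set depth := tukey_depth _ _ => depth0.
have mH (c : nat -> R) : measurable [set w | \sum_(0 <= k < n) c k * t k a <=
                                \sum_(0 <= k < n) c k * t k (X w)].
  apply: measurable_superlevel; apply: measurable_sum => k.
  by apply: measurable_funM => //; exact: measurableT_comp.
have le (c : nat -> R) : (depth <=
    P [set w | (\sum_(0 <= k < n) c k * t k a <=
                \sum_(0 <= k < n) c k * t k (X w))%R])%E.
  pose f (x : 'rV[R]_n) := \sum_(k < n) c k * x ord0 k.
  have lf : linear_for *%R f.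
    move=> b x y; rewrite /f mulr_sumr -big_split/=; apply: eq_bigr => k _.
    by rewrite !mxE; ring.
  pose L : {scalar 'rV[R]_n} := HB.pack f (GRing.isLinear.Build _ _ _ _ f lf).
  have fE x :
      f (coordinates (fun k => t k) n x) = \sum_(0 <= k < n) c k * t k x.
    by rewrite big_mkord; apply: eq_bigr => k _; rewrite mxE.
  apply: ereal_inf_lbound; exists (L : _ -> _); first by exists L.
  rewrite /pushforward /distribution /pushforward /=; congr (P _).
  by apply/seteqP; split=> w /=; rewrite !fE.
have dfin : depth \is a fin_num.
  rewrite ge0_fin_numE; last exact: ltW.
  rewrite (le_lt_trans (le (fun=> 0)))//.
  by rewrite (le_lt_trans (probability_le1 _ (mH _)))// ltry.
exists (fine depth).
  by apply: fine_gt0; rewrite depth0 -ge0_fin_numE ?dfin// ltW.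
by move=> c; apply: fine_le => //; exact: fin_num_measure.
Qed.

Theorem theorem2 (R : realType) (d : measure_display)
    (Omega : measurableType d) (P : probability Omega R)
    (B : topologicalLmodType R) (hB : separable_Fspace B)
    (X : {RV P >-> borel B})
    (t : nat -> {mfun borel B >-> R}) (sigma : nat -> R)
    (indep_tX : mutually_independent P (fun k => t k \o X))
    (sym_tX : forall k, symmetric_rv P (t k \o X))
    (sigma_gt0 : forall k, 0 < sigma k)
    (var_tX : forall k, ('V_P[t k \o X] = (sigma k ^+ 2)%:E)%E)
    (cond : (condition_AI X t /\ condition_AII X t) \/ condition_AIII X t)
    (a : B) :
  (0 < half_space_depth (linear_combinations t) a (distribution P X))%E <->
  (\sum_(0 <= k <oo) (t k a ^+ 2 / sigma k ^+ 2)%:E < +oo)%E.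
Proof.
pose Y k : Omega -> R := t k \o X.
have mY k : measurable_fun setT (Y k) by exact: measurableT_comp.
have Ymean k := has_mean_symmetric_variance (mY k) (sym_tX k) (var_tX k).
have Y1 k : has_mean P (Y k) 0 := (Ymean k).1.
have Y2 k : has_mean P (fun w => Y k w ^+ 2) (sigma k ^+ 2) := (Ymean k).2.
rewrite half_space_depth_linear_combinations_gt0P.
split=> [[h h0 hP]|].
  exact: (half_space_lower_bound_summable mY indep_tX Y1 Y2 sigma_gt0 h0 hP).
have [[AI [c AII]]|[lambda [phi [l0 [[_ id dens] [phi0 _ _ _]]]]]] := cond.
  apply: (summable_half_space_lower_bound (alpha := fun k => t k a) mY
    indep_tX Y1 Y2 sigma_gt0 ltr01 _
    (dual_family_id mY Y1 Y2 AII)); first by rewrite le_max lexx.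
  by move=> N N0; exact: condition_AI_half_space_lower_bound.
have [kappa [C [g [kappa0 C3 gP]]]] :=
  dual_family_identically_distributed mY sym_tX Y2 sigma_gt0 l0 id.
apply: (summable_half_space_lower_bound (alpha := fun k => t k a) mY
    indep_tX Y1 Y2 sigma_gt0 kappa0 C3 gP).
move=> N _; exists (\prod_(0 <= k < N) fine (P (Y k @^-1` `[`|t k a|, +oo[))).
  apply: prodr_gt0 => k _; apply: fine_gt0.
  have mA : measurable (Y k @^-1` `[`|t k a|, +oo[).
    by rewrite -[X in measurable X]setTI; exact: mY.
  rewrite (le_lt_trans (probability_le1 _ mA)) ?ltry// andbT.
  (* The density is that of [Y k / lambda k], so the threshold is rescaled by the same positive
     factor. *)
  have := density_upper_tail_gt0 (`|t k a| / lambda k) (dens k) phi0.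
  congr (_ < P _)%E; apply/seteqP; split=> w /=;
    by rewrite !in_itv/= !andbT ler_pM2r// invr_gt0.
move=> c; exact: symmetric_half_space_lower_bound.
Qed.
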